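(* Let $H$ be a Hadamard matrix of order $v$ and let $A=\begin{bmatrix}I&H\\H^{\top}&I\end{bmatrix}$. Then the hypergraph $([2v],\ \mathfrak B_A(2v,3,-1)\cup\mathfrak B_A(2v,4,-2))$ is a regular $\operatorname{PBD}(2v,\{3,4\},v^2-v)$.
   Context: A complex $v\times v$ matrix $H$ is called Hadamard (of order $v$) if each of its entries has absolute value $1$ and $HH^*=vI$, where $H^*$ denotes the Hermitian transpose of $H$. $[2v]=\{1,\dots,2v\}$. For an $m\times m$ matrix $A$, $\mathfrak B_A(m,k,a)$ is the set of $k$-subsets $\alpha\subset[m]=\{1,\dots,m\}$ with $\det(A[\alpha])=a$, where $A[\alpha]$ is the principal submatrix of $A$ indexed by $\alpha$. For positive integers $m,\lambda$ and a set $K$ of positive integers, a pairwise balanced design $\operatorname{PBD}(m,K,\lambda)$ is an $m$-vertex hypergraph in which the cardinality of each hyperedge belongs to $K$ and every $2$-subset of vertices is contained in exactly $\lambda$ hyperedges. It is called regular if it is a $1$-design, in the sense that every vertex is contained in the same number of hyperedges.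
   Formalization: The entries of H are assumed real, since with the plain transpose the claim fails for complex Hadamard matrices (for H = [[1,i],[i,1]] there are no hyperedges); for v = 1 the index λ = 0 is allowed. *)

(* Defs.v *)
From mathcomp Require Import all_boot all_order all_algebra.
From mathcomp Require Import complex reals.

Set Implicit Arguments.
Unset Strict Implicit.
Unset Printing Implicit Defensive.

Import GRing.Theory Num.Theory.
Local Open Scope ring_scope.

(* These are complex Hadamard matrices. The theorem also assumes that the
   entries of H are real (hence 1 or -1), because A = [[I, H], [H^T, I]] is built
   with the plain transpose and the claim fails over the complex numbers: for
   H = [[1, i], [i, 1]] no principal minor of A of order 3 is -1 and the one of
   order 4 is 5, so there are no hyperedges at all. *)
Definition is_hadamard (R : realType) (v : nat) (H : 'M[R[i]]_v) : Prop :=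
  (forall i j, `|H i j| = 1) /\ H *m map_mx Num.conj H^T = v%:R%:M.

(* The set [m] is represented by 'I_m. *)
Definition principal_submx (R : nzRingType) (m : nat) (A : 'M[R]_m)
  (alpha : {set 'I_m}) : 'M[R]_#|alpha| :=
  mxsub enum_val enum_val A.

Definition minor_blocks (R : comNzRingType) (m : nat) (A : 'M[R]_m)
  (k : nat) (a : R) : {set {set 'I_m}} :=
  [set alpha : {set 'I_m} |
     (#|alpha| == k) && (\det (principal_submx A alpha) == a)].

(* The index lambda may be 0 here; this only occurs for degenerate designs,
   such as the one obtained from a Hadamard matrix of order 1, which has
   two vertices and no hyperedge. *)
Definition is_PBD (T : finType) (E : {set {set T}})
  (m : nat) (K : {pred nat}) (lambda : nat) : Prop :=
  [/\ (0 < m)%N /\ (forall k, k \in K -> (0 < k)%N),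
      #|T| = m,
      (forall e : {set T}, e \in E -> #|e| \in K) &
      (forall p : {set T}, #|p| = 2 ->
         #|[set e in E | p \subset e]| = lambda)].

Definition is_regular (T : finType) (E : {set {set T}}) : Prop :=
  exists r : nat, forall x : T, #|[set e in E | x \in e]| = r.

Definition is_regular_PBD (T : finType) (E : {set {set T}})
  (m : nat) (K : {pred nat}) (lambda : nat) : Prop :=
  is_PBD E m K lambda /\ is_regular E.

(* Main.v *)
(* Let D be the set of row vertices, and split a vertex set into its part X in D
   and its part Y outside D. By a Schur complement, its principal minor is
   det (1 - B^T B), where B is the X by Y block of A. All entries of B square
   to 1, so the minor is 1 if X or Y is empty, 1 - n if one part is a singleton
   and the other has n elements, and 1 or -3 if both parts have two elements.
   Hence the hyperedges are exactly the sets with (|X|, |Y|) equal to (2,1),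
   (1,2), (3,1) or (1,3), and the degrees are sums of products of binomials. *)
Require Import Defs.
From mathcomp Require Import all_boot all_order all_fingroup all_algebra.
From mathcomp Require Import complex reals.
From mathcomp Require Import ring zify.

Local Open Scope ring_scope.

Import GRing.Theory Num.Theory.

(** * Determinants under reindexing and block elimination *)

(** The two enumerations differ by the permutation sending [i] to the [g]-preimage of [f i]. It acts
    on rows and columns alike, so its sign occurs twice and cancels. *)
Lemma det_mxsub_codom (R : comNzRingType) (m : nat) (A : 'M[R]_m)
  (k n : nat) (f : 'I_k -> 'I_m) (g : 'I_n -> 'I_m) :
  injective f -> injective g -> codom f =i codom g ->
  \det (mxsub f f A) = \det (mxsub g g A).
Proof.
move=> f_inj g_inj fg.
have ekn : k = n.
  by have := eq_card fg; rewrite !card_codom // !card_ord.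
subst n.
have fP i : f i \in codom g by rewrite -fg codom_f.
have s_inj : injective (fun i => iinv (fP i)).
  by move=> i j ij; apply: f_inj; rewrite -(f_iinv (fP i)) ij f_iinv.
have -> : mxsub f f A = row_perm (perm s_inj) (col_perm (perm s_inj) (mxsub g g A)).
  by apply/matrixP => i j; rewrite !mxE !permE !f_iinv.
rewrite row_permE col_permE !det_mulmx !det_perm odd_permV.
by rewrite mulrCA -signr_addb addbb mulr1.
Qed.

Lemma det_mx2 (R : comNzRingType) (M : 'M[R]_2) :
  \det M = M 0 0 * M 1 1 - M 0 1 * M 1 0.
Proof.
rewrite (expand_det_row _ 0) !big_ord_recl big_ord0 /cofactor !det_mx11 !mxE /=.
rewrite expr0 expr1 mul1r addr0 mulN1r mulrN.
by congr (_ * M _ _ - M _ _ * M _ _); apply: val_inj.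
Qed.

Lemma codom_enum_val (T : finType) (e : {set T}) (x : T) :
  (x \in codom (@enum_val _ (mem e))) = (x \in e).
Proof.
apply/codomP/idP => [[i ->]|xe]; first exact: enum_valP.
by exists (enum_rank_in xe x); rewrite enum_rankK_in.
Qed.

Lemma det_block1mx1 (R : comNzRingType) (n p : nat) (B : 'M[R]_(n, p)) :
  \det (block_mx 1%:M B B^T 1%:M) = \det (1%:M - B^T *m B).
Proof.
have -> : block_mx 1%:M B B^T 1%:M =
    block_mx 1%:M 0 B^T 1%:M *m block_mx 1%:M B 0 (1%:M - B^T *m B).
  by rewrite mulmx_block !mul1mx !mulmx1 !mul0mx !addr0 addrC subrK.
by rewrite det_mulmx det_lblock det_ublock !det1 !mul1r.
Qed.

(** * Principal minors of bipartite sign matrices *)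

Section Minors.

Context {F : numFieldType}.

Lemma det_sub_gram0 (n p : nat) (B : 'M[F]_(n, p)) :
  p = 0%N -> \det (1%:M - B^T *m B) = 1.
Proof. by move=> p0; subst p; rewrite det_mx00. Qed.

Lemma det_sub_gram1 (n p : nat) (B : 'M[F]_(n, p)) :
  p = 1%N -> (forall i j, B i j ^+ 2 = 1) -> \det (1%:M - B^T *m B) = 1 - n%:R.
Proof.
move=> p1 B2; subst p; rewrite det_mx11 !mxE eqxx; congr (_ - _).
under eq_bigr => i _ do rewrite mxE -expr2 B2.
by rewrite sumr_const card_ord.
Qed.

(** With [t] the product of the four entries and [u] the inner product of the two columns, the
    determinant is [1 - u ^+ 2 = - 1 - 2 t]. The value [-2] would force [2 t = 1], and squaring
    gives [4 = 1], impossible in characteristic 0. *)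
Lemma det_sub_gram2 (n p : nat) (B : 'M[F]_(n, p)) :
  n = 2%N -> p = 2%N -> (forall i j, B i j ^+ 2 = 1) ->
  \det (1%:M - B^T *m B) != - 2%:R.
Proof.
move=> n2 p2 B2; subst n p.
have eB i j : (1%:M - B^T *m B) i j
    = (i == j)%:R - (B 0 i * B 0 j + B 1 i * B 1 j).
  by rewrite !mxE !big_ord_recr big_ord0 /= add0r !mxE; congr (_ - (_ * _ + _ * _));
    congr (B _ _); apply: val_inj.
rewrite det_mx2 !eB /= !mulr0n !mulr1n -!expr2 !B2.
set t := B 0 0 * B 0 1 * (B 1 0 * B 1 1).
have t2 : t ^+ 2 = 1 by rewrite !exprMn !B2 !mulr1.
apply/eqP => det_eq; have : (4%:R : F) = 1%:R; last by move/eqP; rewrite eqr_nat.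
have {det_eq} det_eq : 2%:R * t = 1.
  have : (B 0 0 * B 0 1 + B 1 0 * B 1 1) ^+ 2 = 2%:R + 2%:R * t.
    by rewrite sqrrD !exprMn !B2 !mulr1 -mulr_natl -/t; ring.
  move: det_eq; set u := B 0 0 * _ + _; move=> det_eq u_eq.
  have e1 : (1 - (1 + 1)) * (1 - (1 + 1)) = 1 :> F by ring.
  have e2 : B 0 1 * B 0 0 + B 1 1 * B 1 0 = u by rewrite /u; ring.
  move: det_eq; rewrite e1 e2 !sub0r mulrNN -expr2 u_eq => h.
  have -> : 2%:R * t = - 1 - (1 - (2%:R + 2%:R * t)) by ring.
  by rewrite h; ring.
have <- : (2%:R * t) ^+ 2 = 4%:R by rewrite exprMn t2; ring.
by rewrite det_eq expr1n.
Qed.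

Context (m : nat) (A : 'M[F]_m).

(** Comparing memberships instead of fixing sides makes the notion invariant under complementing
    [D], so each one-sided minor computation serves both sides. *)
Definition bipartite_sign (D : {set 'I_m}) : Prop :=
  (forall x y, (x \in D) = (y \in D) -> A x y = (x == y)%:R) /\
  (forall x y, (x \in D) != (y \in D) -> A y x = A x y /\ A x y ^+ 2 = 1).

Lemma bipartite_signC (D : {set 'I_m}) : bipartite_sign D -> bipartite_sign (~: D).
Proof.
move=> [h1 h2]; split=> x y; rewrite !inE => h.
  by apply: h1; apply: negb_inj.
by apply: h2; apply: contra h => /eqP ->.
Qed.

(** Listing [e] with its part in [D] first turns the submatrix into a block matrix with identity
    diagonal blocks. Later steps need only the squares of the entries of [B], hence the
    existential. *)
Lemma det_principal_bipartite (D : {set 'I_m}) (e : {set 'I_m}) : bipartite_sign D ->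
  exists B : 'M[F]_(#|e :&: D|, #|e :\: D|),
    (forall i j, B i j ^+ 2 = 1) /\
    \det (principal_submx A e) = \det (1%:M - B^T *m B).
Proof.
move=> [h1 h2].
have inX (i : 'I_#|e :&: D|) : enum_val i \in e /\ enum_val i \in D.
  by have := enum_valP i; rewrite inE => /andP[].
have inY (i : 'I_#|e :\: D|) : enum_val i \in e /\ (enum_val i \in D) = false.
  by have := enum_valP i; rewrite inE => /andP[/negbTE-> ->].
exists (mxsub enum_val enum_val A); split=> [i j|].
  by rewrite mxE; apply: (h2 _ _ _).2; rewrite (inX i).2 (inY j).2.
rewrite -det_block1mx1.
pose f (i : 'I_(#|e :&: D| + #|e :\: D|)) : 'I_m :=
  match split i with inl j => enum_val j | inr j => enum_val j end.
have fl j : f (lshift _ j) = enum_val j by rewrite /f (unsplitK (inl _ j)).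
have fr j : f (rshift _ j) = enum_val j by rewrite /f (unsplitK (inr _ j)).
rewrite [LHS](_ : _ = \det (mxsub f f A)); last first.
  rewrite /principal_submx; apply: det_mxsub_codom; first exact: enum_val_inj.
    move=> i j; case: (split_ordP i) => i' ->; case: (split_ordP j) => j' ->;
      rewrite ?fl ?fr => ij.
    - by rewrite (enum_val_inj ij).
    - by have := (inX i').2; rewrite ij (inY j').2.
    - by have := (inX j').2; rewrite -ij (inY i').2.
    - by rewrite (enum_val_inj ij).
  move=> x; rewrite codom_enum_val; apply/idP/codomP => [xe|[i ->]]; last first.
    by case: (split_ordP i) => i' ->; rewrite ?fl ?fr ?(inX i').1 ?(inY i').1.
  have [xD|xD] := boolP (x \in D).
    have xX : x \in e :&: D by rewrite inE xe xD.
    by exists (lshift _ (enum_rank_in xX x)); rewrite fl enum_rankK_in.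
  have xY : x \in e :\: D by rewrite inE xe xD.
  by exists (rshift _ (enum_rank_in xY x)); rewrite fr enum_rankK_in.
congr (\det _); apply/matrixP => i j.
rewrite mxE; case: (split_ordP i) => i' ->; case: (split_ordP j) => j' ->;
  rewrite ?fl ?fr ?block_mxEul ?block_mxEur ?block_mxEdl ?block_mxEdr !mxE.
- by rewrite h1 ?(inX i').2 ?(inX j').2 // (inj_eq enum_val_inj).
- by [].
- by apply: (h2 _ _ _).1; rewrite (inX j').2 (inY i').2.
- by rewrite h1 ?(inY i').2 ?(inY j').2 // (inj_eq enum_val_inj).
Qed.

Lemma onesub_natr_eq (x n : nat) : (1 - x%:R == - n%:R :> F) = (x == n.+1).
Proof. by rewrite subr_eq addrC eq_sym subr_eq nat1r eqr_nat. Qed.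

Lemma mem_minor_blocks34 (D e : {set 'I_m}) : bipartite_sign D ->
  (e \in minor_blocks A 3 (-1) :|: minor_blocks A 4 (- 2%:R)) =
  ((#|e :&: D|, #|e :\: D|) \in [:: (2, 1); (1, 2); (3, 1); (1, 3)]%N).
Proof.
move=> hD; have card_e := cardsID D e; rewrite !inE !xpair_eqE.
have det0 C : bipartite_sign C -> #|e :\: C| = 0%N -> \det (principal_submx A e) = 1.
  move=> hC C0; have [B [_ ->]] := det_principal_bipartite C e hC.
  exact: det_sub_gram0.
have det1 C : bipartite_sign C -> #|e :\: C| = 1%N ->
    \det (principal_submx A e) = 1 - #|e :&: C|%:R.
  move=> hC C1; have [B [B2 ->]] := det_principal_bipartite C e hC.
  exact: det_sub_gram1.
have := (det0 _ hD, det1 _ hD).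
have := (det0 _ (bipartite_signC _ hD), det1 _ (bipartite_signC _ hD)).
have : #|e :&: D| = 2%N -> #|e :\: D| = 2%N -> \det (principal_submx A e) != - 2%:R.
  move=> hx hy; have [B [B2 ->]] := det_principal_bipartite D e hD.
  exact: det_sub_gram2.
(* The facts for [D] and for its complement now speak of the same two cardinals, so the rest is a
   case analysis on numbers. *)
rewrite -(setDE e D) (setDE e (~: D)) setCK; move: (\det _) => d; rewrite -card_e.
move: #|e :&: D| #|e :\: D| {card_e} => x y.
have one_eq n : (1 == - n%:R :> F) = false.
  by have := onesub_natr_eq 0 n; rewrite subr0.
have e1 n : (1 - n%:R == -1 :> F) = (n == 2%N) := onesub_natr_eq n 1.
case: x => [|[|x]] d22 [x0 x1] [y0 y1].
- by rewrite x0 // (one_eq 1%N) one_eq !andbF.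
- by rewrite x1 // e1 onesub_natr_eq; case: y {d22 x0 x1 y0 y1} => [|[|[|[|y]]]].
case: y d22 x0 x1 y0 y1 => [|[|y]] d22 _ _ y0 y1.
- by rewrite y0 // (one_eq 1%N) one_eq !andbF.
- by rewrite y1 // e1 onesub_natr_eq addn1; case: x {d22 y0 y1} => [|[|x]].
(* Both parts have at least two elements here, so a total of 3 or 4 leaves only the split (2, 2). *)
case: x y d22 {y0 y1} => [|x] [|y] d22; rewrite ?addSn ?addnS ?andbF //=.
by rewrite (negbTE (d22 _ _)).
Qed.

(** * Counting sets with a prescribed split *)

Definition split_blocks (a b : nat) (D : {set 'I_m}) : {set {set 'I_m}} :=
  [set e : {set 'I_m} | (#|e :&: D| == a) && (#|e :\: D| == b)].

(* The two comparisons guard the truncated subtractions. *)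
Lemma card_split_blocks_supset (D p : {set 'I_m}) (a b : nat) :
  #|[set e in split_blocks a b D | p \subset e]| =
  ((#|p :&: D| <= a) * 'C(#|D :\: p|, a - #|p :&: D|) *
   ((#|p :\: D| <= b) * 'C(#|~: D :\: p|, b - #|p :\: D|)))%N.
Proof.
have [pa|pa] := leqP; last first.
  rewrite /= !mul0n; apply: eq_card0 => e; rewrite !inE.
  apply/negbTE; apply: contraTN pa; rewrite -leqNgt => /andP[/andP[/eqP<- _] pe].
  by apply: subset_leq_card; apply: setSI.
have [pb|pb] := leqP; last first.
  rewrite /= mul0n muln0; apply: eq_card0 => e; rewrite !inE.
  apply/negbTE; apply: contraTN pb; rewrite -leqNgt => /andP[/andP[_ /eqP<-] pe].
  by apply: subset_leq_card; apply: setSD.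
rewrite !mul1n -!cards_draws -cardsX.
(* A superset of [p] amounts to a free choice of its new elements inside and outside [D]; [join]
   glues such a choice to [p]. *)
pose join (z : {set 'I_m} * {set 'I_m}) := p :|: (z.1 :|: z.2).
have joinI (z : {set 'I_m} * {set 'I_m}) :
    z.1 \subset D :\: p -> z.2 \subset ~: D :\: p ->
    join z :&: (D :\: p) = z.1 /\ join z :&: (~: D :\: p) = z.2.
  move=> /subsetP h1 /subsetP h2; split; apply/setP => x; move: (h1 x) (h2 x);
  rewrite !inE; case: (x \in p); case: (x \in D); case: (x \in z.1);
  by case: (x \in z.2) => // c1 c2; (have := c1 isT) || have := c2 isT.
have splitI (e C : {set 'I_m}) : p \subset e -> #|e :&: C| = (#|p :&: C| + #|e :&: (C :\: p)|)%N.
  by move=> pe; rewrite -(cardsID p (e :&: C)) setIDA setIAC (setIidPr pe).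
rewrite -(card_in_imset (f := join)).
  apply: eq_card => e; rewrite !inE (setDE e) (setDE p); apply/idP/imsetP.
    move=> /andP[/andP[ea eb] pe].
    exists (e :&: (D :\: p), e :&: (~: D :\: p)).
      rewrite !inE /= !subsetIr /=; move: ea eb; rewrite (splitI e D) // (splitI e (~: D)) //.
      by move=> /eqP<- /eqP<-; rewrite !addKn !eqxx.
    apply/setP => x; rewrite !inE; have := subsetP pe x.
    by case: (x \in p) => [->|_] //; case: (x \in D); case: (x \in e).
  move=> [z]; rewrite !inE => /andP[/andP[z1 a1] /andP[z2 a2]] ->.
  have pz : p \subset join z by apply: subsetUl.
  have [j1 j2] := joinI z z1 z2.
  rewrite (splitI _ D) // (splitI _ (~: D)) // j1 j2 pz (eqP a1) (eqP a2).
  by rewrite -(setDE p) !subnKC // !eqxx.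
move=> z z'; rewrite !inE => /andP[/andP[z1 a1] /andP[z2 a2]] /andP[/andP[z1' a1'] /andP[z2' a2']].
move: (joinI z z1 z2) (joinI z' z1' z2') => [j1 j2] [j1' j2'] E.
by rewrite [z]surjective_pairing [z']surjective_pairing -j1 -j2 -j1' -j2' E.
Qed.

End Minors.

(** * Vertex degrees and pair degrees of the design *)

Theorem theorem4p2 (R : realType) (v : nat) (hv : (0 < v)%N)
  (H : 'M[R[i]]_v) (hH : is_hadamard H)
  (hreal : forall i j, H i j \is Num.real) :
  let A := block_mx 1%:M H H^T 1%:M : 'M[R[i]]_(v + v) in
  is_regular_PBD (minor_blocks A 3 (-1) :|: minor_blocks A 4 (- 2%:R))
    (2 * v)%N (mem [:: 3; 4]%N) (v ^ 2 - v)%N.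
Proof.
move=> A.
pose D : {set 'I_(v + v)} := [set lshift v i | i : 'I_v].
have lD i : lshift v i \in D by apply: imset_f.
have rD i : (rshift v i \in D) = false.
  by apply/imsetP => -[j _ /eqP]; rewrite eq_rlshift.
have cardD : #|D| = v by rewrite card_imset ?card_ord //; apply: lshift_inj.
have cardDC : #|~: D| = v by have := cardsC D; rewrite cardD card_ord => /addnI.
(* Realness enters here: the square of a real entry is its squared modulus. *)
have H2 i j : H i j ^+ 2 = 1 by rewrite -real_normK // hH.1 expr1n.
have hD : bipartite_sign _ A D.
  split=> x y; case: (split_ordP x) => i ->; case: (split_ordP y) => j ->;
    rewrite ?lD ?rD // => _;
    rewrite ?block_mxEul ?block_mxEur ?block_mxEdl ?block_mxEdr !mxE;
    by rewrite ?eq_lshift ?eq_rshift.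
pose E := minor_blocks A 3 (-1) :|: minor_blocks A 4 (- 2%:R); rewrite -/E.
have degree (p : {set 'I_(v + v)}) (i j : nat) : #|p :&: D| = i -> #|p :\: D| = j ->
    #|[set e in E | p \subset e]| =
    (\sum_(ab <- [:: (2, 1); (1, 2); (3, 1); (1, 3)])
      (i <= ab.1) * 'C(v - i, ab.1 - i) * ((j <= ab.2) * 'C(v - j, ab.2 - j)))%N.
  move=> pi pj.
  have cD : #|D :\: p| = (v - i)%N by rewrite cardsD cardD setIC pi.
  have cDC : #|~: D :\: p| = (v - j)%N by rewrite cardsD cardDC setIC -setDE pj.
  rewrite -pi -pj in cD cDC *; rewrite -cD -cDC.
  under eq_bigr => ab _ do rewrite -card_split_blocks_supset.
  rewrite !big_cons big_nil addn0 -!sum1_card /=.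
  (* Cardinals become sums of indicators, compared at each [e]: a hyperedge has exactly one of the
     four splits. *)
  rewrite !(big_mkcond (fun e => e \in _)) -!big_split /=; apply: eq_bigr => e _.
  rewrite [in LHS]in_set (mem_minor_blocks34 _ A D e hD) !inE !xpair_eqE.
  case: (p \subset e); rewrite ?andbF // !andbT.
  by move: #|_| #|_| => [|[|[|[|x]]]] [|[|[|[|y]]]].
split; last first.
  (* This is the degree of a row vertex. Column vertices have the same one, since swapping
     coordinates preserves the list of splits. *)
  exists (\sum_(ab <- [:: (2, 1); (1, 2); (3, 1); (1, 3)])
    (1 <= ab.1) * 'C(v - 1, ab.1 - 1) * ((0 <= ab.2) * 'C(v - 0, ab.2 - 0)))%N => x.
  have -> : [set e in E | x \in e] = [set e in E | [set x] \subset e].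
    by apply/setP => e; rewrite !in_set sub1set.
  have := cardsID D [set x]; rewrite cards1.
  have [xD|xD] := boolP (x \in D) => card_x.
    have x1 : #|[set x] :&: D| = 1%N.
      by rewrite (setIidPl _) ?sub1set // cards1.
    by apply: degree => //; apply: (@addnI 1%N); rewrite -[in LHS]x1 card_x.
  have x0 : #|[set x] :&: D| = 0%N.
    by apply/eqP; rewrite cards_eq0 setI_eq0 disjoints1.
  rewrite (degree _ 0%N 1%N) //; last by rewrite -card_x x0.
  by rewrite !big_cons !big_nil /=; ring.
split.
- by split=> [|k]; rewrite ?muln_gt0 // !inE => /orP[] /eqP->.
- by rewrite card_ord mul2n addnn.
- by move=> e; rewrite /E !inE => /orP[] /andP[-> _]; rewrite ?orbT.
move=> p p2; have := cardsID D p; rewrite p2.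
(* These bounds give [2 <= v] when both points lie on one side, so that [v - 2] is not truncated. *)
have pi_le : (#|p :&: D| <= v)%N by have := subset_leq_card (subsetIr p D); rewrite cardD.
have pj_le : (#|p :\: D| <= v)%N.
  by have := subset_leq_card (subsetIr p (~: D)); rewrite cardDC setDE.
rewrite (degree p _ _ erefl erefl) !big_cons big_nil.
(* The splits (0, 2), (1, 1), (2, 0) of [p] remain. A pair on one side has degree [v + v (v - 2)], a
   mixed pair [2 (v - 1) + 2 'C(v - 1, 2)]. *)
case: #|p :&: D| pi_le => [|[|[|?]]] //; case: #|p :\: D| pj_le => [|[|[|?]]] //= h h' _.
all: rewrite !(subn0, subnn, bin0, bin1, mul1n, muln1, mul0n, muln0, addn0, add0n).
- by nia.
- have [n vn] : exists n, v = n.+1 by exists v.-1; rewrite prednK.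
  (* The identity [n * n.-1 = 2 * 'C(n, 2)] reduces the mixed case to polynomial arithmetic. *)
  have := mul_bin_diag n 1; rewrite bin1 vn subn1 /= -[(3 - 1)%N]/2%N.
  by case: n {vn} => [|n] /=; [rewrite !bin_small | move: 'C(_, _) => c; nia].
- by nia.
Qed.
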